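(* Let $G$ be a graph of order $n$ with $\kappa_3(G)=2$, and let $e(G)$ denote its number of edges. Then $e(G)\geq \frac{6}{5}n$. Moreover, this lower bound is sharp: there exist graphs $G$ with $\kappa_3(G)=2$ and $e(G)=\frac{6}{5}v(G)$, where $v(G)$ is the order of $G$.
   Context: All graphs are finite and simple. For a nontrivial connected graph $G$ of order $n$ and an integer $k$ with $2\le k\le n$, and a set $S$ of $k$ vertices of $G$, $\kappa(S)$ denotes the maximum number $\ell$ of edge-disjoint trees $T_1,\dots,T_\ell$ in $G$ such that $V(T_i)\cap V(T_j)=S$ for every pair of distinct $i,j$ (such trees are called internally disjoint trees connecting $S$). The $k$-connectivity of $G$ is $\kappa_k(G)=\min\{\kappa(S)\}$, the minimum taken over all $k$-subsets $S$ of $V(G)$. In particular $\kappa_3(G)$ is the minimum of $\kappa(S)$ over all 3-element vertex sets $S$. *)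

(* Defs.v *)
From mathcomp Require Import all_boot all_order all_algebra.

Set Implicit Arguments.
Unset Strict Implicit.
Unset Printing Implicit Defensive.

Record sgraph := SGraph {
  vertex :> finType;
  adj : rel vertex;
  adj_sym : symmetric adj;
  adj_irrefl : irreflexive adj
}.

Definition edges (G : sgraph) : {set {set G}} :=
  [set [set p.1; p.2] | p : G * G & adj p.1 p.2].

Definition connected (G : sgraph) : bool :=
  (0 < #|G|) && [forall x : G, forall y : G, connect (@adj G) x y].

(* The length bounds only serve to make the quantifier finite, see acyclicP.
   Sequences [:: x; y] with e x y and e y x are not cycles of a simple graph. *)
Definition acyclic (T : finType) (e : rel T) : bool :=
  [forall n : 'I_#|T|.+1, forall c : n.-tuple T, ucycleb e c ==> (n < 3)].

Lemma acyclicP (T : finType) (e : rel T) :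
  reflect (forall c : seq T, ucycle e c -> size c < 3) (acyclic e).
Proof.
apply: (iffP forallP) => [ac c cc | ac n].
  have /andP[_ uc] := cc.
  have lec : size c < #|T|.+1 by rewrite ltnS -(card_uniqP uc) max_card.
  have /forallP/(_ (in_tuple c)) := ac (Ordinal lec).
  by move/implyP; apply.
apply/forallP => c; apply/implyP => cc.
by have := ac c cc; rewrite size_tuple.
Qed.

(* A vertex set and an edge set, not yet required to form a subgraph of G. *)
Notation presubgraph G := ({set G} * {set {set G}})%type.

Section Connectivity.
Variable G : sgraph.
Local Notation subgr := (presubgraph G).

Definition sub_vertices (H : subgr) : {set G} := H.1.
Definition sub_edges (H : subgr) : {set {set G}} := H.2.

Definition sub_adj (H : subgr) : rel G :=
  fun x y => [set x; y] \in sub_edges H.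

Definition is_subgraph (H : subgr) : bool :=
  (sub_edges H \subset edges G)
  && [forall A in sub_edges H, A \subset sub_vertices H].

Definition is_tree (H : subgr) : bool :=
  [&& is_subgraph H,
      sub_vertices H != set0,
      [forall x in sub_vertices H, forall y in sub_vertices H,
         connect (sub_adj H) x y]
    & acyclic (sub_adj H)].

(* Families are sets of trees rather than indexed families: if 2 <= #|S|, every
   tree containing S has an edge, so edge-disjoint trees are distinct. *)
Definition internally_disjoint_trees (S : {set G}) (P : {set subgr}) : bool :=
  [forall H in P, is_tree H && (S \subset sub_vertices H)]
  && [forall H1 in P, forall H2 in P, (H1 != H2) ==>
        [disjoint sub_edges H1 & sub_edges H2]
        && (sub_vertices H1 :&: sub_vertices H2 == S)].

Definition kappa (S : {set G}) : nat :=
  \max_(P : {set subgr} | internally_disjoint_trees S P) #|P|.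

(* The default #|edges G| is never below kappa S, so for 2 <= k <= #|G| this is
   the minimum of kappa over the k-subsets, see kconnectivity_min. *)
Definition kconnectivity (k : nat) : nat :=
  \big[minn/#|edges G|]_(S : {set G} | #|S| == k) kappa S.

Lemma tree_has_edge (S : {set G}) (H : subgr) :
  1 < #|S| -> is_tree H -> S \subset sub_vertices H -> sub_edges H != set0.
Proof.
case/card_gt1P=> x [y [Sx Sy nxy]] /and4P[_ _ conH _] /subsetP sSH.
have /forall_inP/(_ y (sSH y Sy)) := forall_inP conH x (sSH x Sx).
case/connectP => [[|z p]] /=; first by move=> _ eyx; rewrite eyx eqxx in nxy.
by case/andP=> Hxz _ _; apply/set0Pn; exists [set x; z].
Qed.

Lemma kappa_le_edges (S : {set G}) : 1 < #|S| -> kappa S <= #|edges G|.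
Proof.
move=> S1; apply/bigmax_leqP => P /andP[/forall_inP treeP /forall_inP disP].
pose f (H : subgr) := odflt set0 [pick A in sub_edges H].
have fP H : H \in P -> f H \in sub_edges H.
  move=> PH; have /andP[tH sH] := treeP H PH.
  rewrite /f; case: pickP => [A //|no].
  have /set0Pn[A HA] := tree_has_edge S1 tH sH.
  by have := no A; rewrite HA.
rewrite -(card_in_imset (f := f) (D := mem P)).
  apply/subset_leq_card/subsetP=> _ /imsetP[H PH ->].
  have /andP[/and4P[/andP[/subsetP sub _] _ _ _] _] := treeP H PH.
  exact/sub/fP.
move=> H1 H2 P1 P2 ef; apply/eqP/negPn/negP=> n12.
have /implyP/(_ n12)/andP[dis _] := forall_inP (disP H1 P1) H2 P2.
have := disjointFr dis (fP _ P1).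
by rewrite ef fP.
Qed.

Lemma kconnectivity_min (k : nat) : 2 <= k <= #|G| ->
  (exists2 S : {set G}, #|S| = k & kappa S = kconnectivity k) /\
  (forall S : {set G}, #|S| = k -> kconnectivity k <= kappa S).
Proof.
case/andP=> k2 kn.
have minle (S : {set G}) : #|S| = k -> kconnectivity k <= kappa S.
  move/eqP=> Sk; rewrite /kconnectivity.
  elim: (index_enum _) (mem_index_enum S) => // S' r IHr.
  rewrite inE big_cons; case/predU1P=> [<-|/IHr le]; first by rewrite Sk geq_minl.
  by case: ifP => // _; apply: leq_trans le; apply: geq_minr.
split=> //.
have [S0 Sk0] : exists S : {set G}, #|S| = k.
  have [] := @eqP _ #|[set S : {set G} | #|S| == k]| 0; last first.
    by move/eqP; rewrite cards_eq0 => /set0Pn[S]; rewrite inE => /eqP; exists S.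
  by move=> c0; have := card_draws G k; rewrite c0 => /esym/eqP;
    rewrite -leqn0 leqNgt bin_gt0 kn.
have [e|//] : kconnectivity k = #|edges G| \/
   (exists2 S : {set G}, #|S| = k & kappa S = kconnectivity k).
  rewrite {1}/kconnectivity /kconnectivity.
  elim/big_ind: _ => [|a b Ha Hb|S /eqP Sk]; [by left| |by right; exists S].
  by rewrite /minn; case: ifP.
exists S0 => //; apply/eqP; rewrite eqn_leq minle // andbT e.
by apply: kappa_le_edges; rewrite Sk0.
Qed.

End Connectivity.

(* Main.v *)
Require Import Defs.
From mathcomp Require Import all_boot all_order all_algebra.
From mathcomp Require Import zify lra.

(** Two internally disjoint trees through every triple force minimum degree at
    least 2. They also force the set [X] of degree-2 vertices to be independent:
    if [u] and [v] in [X] are adjacent, the tree using [uv] has to leave [{u, v}]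
    towards a third terminal, say at [u], which leaves no edge at [u] for the
    other tree. Counting incidences gives [2 |X| <= e] and
    [2 |X| + 3 (n - |X|) <= 2 e], whence [6 n <= 5 e]. Equality forces a cubic
    multigraph with every edge subdivided once; the smallest one is K_{2,3}. *)

Set Implicit Arguments.
Unset Strict Implicit.
Unset Printing Implicit Defensive.

Lemma set2_eqP (T : finType) (a b c d : T) :
  [set a; b] = [set c; d] -> (a = c /\ b = d) \/ (a = d /\ b = c).
Proof.
move=> E.
have := set21 a b; rewrite E => /set2P ha.
have := set22 a b; rewrite E => /set2P hb.
have := set21 c d; rewrite -E => /set2P hc.
have := set22 c d; rewrite -E => /set2P hd.
by case: ha hb hc hd => [->|->] [->|->] [] ? [] ?; subst; auto.
Qed.

Lemma connect_exit (T : finType) (e : rel T) (A : {set T}) (x y : T) :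
  connect e x y -> x \in A -> y \notin A ->
  exists a b, [/\ a \in A, b \notin A & e a b].
Proof.
case/connectP => s + ->; elim: s x => [|z s IH] x /=.
  by move=> _ ->.
case/andP => exz es Ax; case: (boolP (z \in A)) => [Az|nAz _].
  exact: IH.
by exists x, z.
Qed.

(** * Degrees and internally disjoint trees *)

Section Incidence.
Variable G : sgraph.
Implicit Types (u v w : G) (S : {set G}) (H : presubgraph G).

Definition incident v : {set {set G}} := [set A in edges G | v \in A].

Lemma card_edge (A : {set G}) : A \in edges G -> #|A| = 2.
Proof.
case/imsetP => -[x y]; rewrite inE /= => xy ->; rewrite cards2.
by case: eqVneq xy => // ->; rewrite adj_irrefl.
Qed.

(** Double counting of incident pairs [(v, A)]. With [X] full it gives the handshake lemma; with [X]
    independent each summand on the right is at most 1. *)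
Lemma sum_incident (X : {set G}) :
  \sum_(v in X) #|incident v| = \sum_(A in edges G) #|A :&: X|.
Proof.
under eq_bigr => v _.
  rewrite -sum1_card (eq_bigl (fun A => (A \in edges G) && (v \in A))); last first.
    by move=> A; rewrite inE.
  over.
rewrite (exchange_big_dep (fun A => A \in edges G)) /=; last by move=> ? ? _ /andP[].
apply: eq_bigr => A EA; rewrite -sum1_card; apply: eq_bigl => v.
by rewrite EA inE andbC.
Qed.

Lemma tree_incident S H v : 1 < #|S| -> v \in S -> is_tree H ->
  S \subset sub_vertices H -> exists2 A, A \in incident v & A \in sub_edges H.
Proof.
move=> S1 Sv /and4P[/andP[/subsetP subE _] _ conH _] /subsetP sSH.
have [w Sw nwv] : exists2 w, w \in S & w != v.
  have [x [y [Sx Sy nxy]]] := card_gt1P S1.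
  by case: (eqVneq x v) nxy => [->|nxv] nxy; [exists y; rewrite // eq_sym | exists x].
have conn := forall_inP (forall_inP conH v (sSH v Sv)) w (sSH w Sw).
have [||a [b [/set1P-> _ eab]]] := connect_exit (A := [set v]) conn.
- exact: set11.
- by rewrite inE.
by exists [set v; b] => //; rewrite inE (subE _ eab) set21.
Qed.

(** Each tree contains an edge at the terminal [v]; choosing one per tree is injective because the
    trees are edge-disjoint. *)
Lemma kappa_le_degree S v : 1 < #|S| -> v \in S -> kappa S <= #|incident v|.
Proof.
move=> S1 Sv; apply/bigmax_leqP => P /andP[/forall_inP treeP /forall_inP disP].
pose f H := odflt set0 [pick A in incident v :&: sub_edges H].
have fP H : H \in P -> f H \in incident v :&: sub_edges H.
  move=> PH; have /andP[tH sH] := treeP H PH.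
  have [A IA HA] := tree_incident S1 Sv tH sH.
  by rewrite /f; case: pickP => [//|/(_ A)]; rewrite inE IA HA.
rewrite -(card_in_imset (f := f) (D := mem P)).
  apply/subset_leq_card/subsetP=> _ /imsetP[H PH ->].
  by have /setIP[] := fP H PH.
move=> H1 H2 P1 P2 ef; apply/eqP/negPn/negP=> n12.
have /implyP/(_ n12)/andP[dis _] := forall_inP (disP H1 P1) H2 P2.
have /setIP[_ f1] := fP _ P1; have /setIP[_ f2] := fP _ P2.
by have := disjointFr dis f1; rewrite ef f2.
Qed.

Lemma kappa_ge2P S : 1 < #|S| ->
  reflect (exists H1 H2, [/\ is_tree H1 /\ S \subset sub_vertices H1,
      is_tree H2 /\ S \subset sub_vertices H2,
      [disjoint sub_edges H1 & sub_edges H2]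
    & sub_vertices H1 :&: sub_vertices H2 = S]) (2 <= kappa S).
Proof.
move=> S1; apply: (iffP idP) => [|[H1 [H2 [[t1 s1] [t2 s2] dis cap]]]].
  have [P dP ->] : exists2 P : {set presubgraph G},
      internally_disjoint_trees S P & kappa S = #|P|.
    (* The empty family is admissible, so the maximum defining [kappa S] is attained. *)
    have d0 : internally_disjoint_trees S set0.
      by apply/andP; split; apply/forall_inP => H; rewrite inE.
    by rewrite /kappa (bigmax_eq_arg _ d0); case: arg_maxnP => // P; exists P.
  case/card_gt1P => H1 [H2 [P1 P2 n12]].
  have /andP[/forall_inP treeP /forall_inP disP] := dP.
  have /andP[t1 s1] := treeP _ P1; have /andP[t2 s2] := treeP _ P2.
  have /implyP/(_ n12)/andP[dis /eqP cap] := forall_inP (disP H1 P1) H2 P2.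
  by exists H1, H2.
have n12 : H1 != H2.
  apply/eqP => E; have /set0Pn[A A1] := tree_has_edge S1 t1 s1.
  by have := disjointFr dis A1; rewrite -E A1.
have <- : #|[set H1; H2]| = 2 by rewrite cards2 n12.
apply: (@leq_bigmax_cond _ _ (fun P : {set presubgraph G} => #|P|)).
apply/andP; split; first by apply/forall_inP => H /set2P[] ->; apply/andP.
apply/forall_inP => H /set2P[] ->; apply/forall_inP => H' /set2P[] ->.
- by rewrite eqxx.
- by rewrite dis cap eqxx implybT.
- by rewrite disjoint_sym dis setIC cap eqxx implybT.
- by rewrite eqxx.
Qed.

(** [H2] needs an edge at the terminal [u] too, and it would be a third one. *)
Lemma tree_exhausts_degree2 S H1 H2 u x v : 1 < #|S| -> u \in S ->
  #|incident u| <= 2 -> is_tree H1 -> is_tree H2 -> S \subset sub_vertices H2 ->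
  [disjoint sub_edges H1 & sub_edges H2] -> x != v ->
  sub_adj H1 u v -> sub_adj H1 u x -> False.
Proof.
move=> S1 Su du t1 t2 s2 dis nxv uv ux.
have [A IA A2] := tree_incident S1 Su t2 s2.
have /and4P[/andP[/subsetP subE _] _ _ _] := t1.
have nA B : B \in sub_edges H1 -> A != B.
  by move=> B1; apply: contraTneq A2 => ->; rewrite (disjointFr dis B1).
suff : 2 < #|incident u| by rewrite ltnNge du.
apply/card_gt2P; exists A, [set u; v], [set u; x]; split.
- by split=> //; rewrite inE (subE _ uv, subE _ ux) set21.
- split; rewrite ?nA // 1?eq_sym ?nA //.
  by apply: contraNneq nxv => /set2_eqP[[_ ->]|[-> ->]].
Qed.

Lemma degree2_nonadjacent u v w : 2 <= kappa [set u; v; w] ->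
  w \notin [set u; v] -> #|incident u| <= 2 -> #|incident v| <= 2 -> ~~ adj u v.
Proof.
move=> k2 nw du dv; apply/negP => uv.
have nuv : u != v by apply: contraTneq uv => ->; rewrite adj_irrefl.
pose S := [set u; v; w].
have S1 : 1 < #|S| by apply/card_gt1P; exists u, v; rewrite !inE !eqxx orbT.
have Su : u \in S by rewrite !inE eqxx.
have Sv : v \in S by rewrite !inE eqxx orbT.
have Sw : w \in S by rewrite !inE eqxx orbT.
have [H1 [H2 [[t1 s1] [t2 s2] dis _]]] := kappa_ge2P S1 k2.
have noedge H H' : is_tree H -> S \subset sub_vertices H ->
    is_tree H' -> S \subset sub_vertices H' ->
    [disjoint sub_edges H & sub_edges H'] -> ~~ sub_adj H u v.
  move=> t s t' s' d; apply/negP => Huv.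
  have Hvu : sub_adj H v u by rewrite /sub_adj setUC.
  have /and4P[_ _ conH _] := t; move/subsetP: (s) => sSH.
  have conn := forall_inP (forall_inP conH u (sSH u Su)) w (sSH w Sw).
  have [||a [b [/set2P[]-> nb eab]]] := connect_exit (A := [set u; v]) conn => //.
  - by rewrite set21.
  - apply: (tree_exhausts_degree2 S1 Su du t t' s' d _ Huv eab).
    by apply: contraNneq nb => ->; rewrite set22.
  - apply: (tree_exhausts_degree2 S1 Sv dv t t' s' d _ Hvu eab).
    by apply: contraNneq nb => ->; rewrite set21.
have n1 := noedge _ _ t1 s1 t2 s2 dis.
have n2 := noedge _ _ t2 s2 t1 s1; rewrite disjoint_sym in n2; have {}n2 := n2 dis.
(* Neither tree uses [[set u; v]], so this edge and one edge from each tree are three edges at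
   [u]. *)
have [A IA A1] := tree_incident S1 Su t1 s1.
have [B IB B2] := tree_incident S1 Su t2 s2.
suff : 2 < #|incident u| by rewrite ltnNge du.
apply/card_gt2P; exists A, B, [set u; v]; split.
- split=> //; rewrite !inE eqxx andbT.
  by apply/imsetP; exists (u, v); rewrite ?inE.
- split.
  + by apply: contraTneq B2 => <-; rewrite (disjointFr dis A1).
  + by apply: contraNneq n2 => E; rewrite /sub_adj -E.
  + by apply: contraNneq n1 => E; rewrite /sub_adj E.
Qed.

(** * The lower bound *)

Lemma edges_lower_bound : 3 <= #|G| -> 2 <= kconnectivity G 3 ->
  6 * #|G| <= 5 * #|edges G|.
Proof.
move=> n3 k2.
have [_ kmin] := @kconnectivity_min G 3 n3.
have kappa2 S : #|S| = 3 -> 2 <= kappa S by move/kmin; apply: leq_trans.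
have third u v : exists w, w \notin [set u; v].
  apply/existsP; rewrite -negb_forall; apply/negP => /forallP all2.
  have : #|G| <= #|[set u; v]| by apply/subset_leq_card/subsetP.
  by rewrite cards2; case: (u != v) => /= /(leq_trans n3).
have deg2 v : 2 <= #|incident v|.
  have [u nu] := third v v; have [w nw] := third v u.
  have S3 : #|[set v; u; w]| = 3.
    rewrite setUC cardsU1 nw cards2; move: nu.
    by rewrite !inE orbb eq_sym => ->.
  apply: leq_trans (kappa2 _ S3) (kappa_le_degree _ _); first by rewrite S3.
  by rewrite !inE eqxx.
pose X := [set v | #|incident v| <= 2].
have indep u v : u \in X -> v \in X -> ~~ adj u v.
  rewrite !inE => du dv; apply/negP => uv.
  have nuv : u != v by apply: contraTneq uv => ->; rewrite adj_irrefl.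
  have [w nw] := third u v.
  have S3 : #|[set u; v; w]| = 3 by rewrite setUC cardsU1 nw cards2 nuv.
  by have := degree2_nonadjacent (kappa2 _ S3) nw du dv; rewrite uv.
(* Vertices of [X] have degree at least 2, and by independence no edge has both ends in [X]. *)
have cX : 2 * #|X| <= #|edges G|.
  rewrite mulnC -sum_nat_const -[leqRHS]sum1_card.
  apply: (@leq_trans (\sum_(v in X) #|incident v|)); first exact: leq_sum.
  rewrite sum_incident; apply: leq_sum => A EA.
  apply/card_le1_eqP => x y /setIP[Ax Xx] /setIP[Ay Xy]; apply/eqP/negPn/negP => nxy.
  have /imsetP[[a b]] := EA; rewrite inE /= => ab EAab.
  have := indep x y Xx Xy; rewrite EAab in Ax Ay.
  case/set2P: Ax nxy => ->; case/set2P: Ay => ->; rewrite ?eqxx // => _.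
    by rewrite ab.
  by rewrite adj_sym ab.
have c2 : \sum_(v : G) #|incident v| = 2 * #|edges G|.
  have := sum_incident setT; under eq_bigl do rewrite inE; move=> ->.
  rewrite mulnC -sum_nat_const; apply: eq_bigr => A EA.
  by rewrite setIT card_edge.
have cXC : 2 * #|X| + 3 * #|~: X| <= 2 * #|edges G|.
  rewrite -c2 (bigID (mem X)) /= mulnC -sum_nat_const mulnC -sum_nat_const.
  apply: leq_add; first exact: leq_sum.
  under [leqLHS]eq_bigl do rewrite inE.
  by apply: leq_sum => v; rewrite inE -ltnNge.
(* With [n = #|G|] and [e = #|edges G|], [cXC] reads [3n <= 2e + #|X|]; doubling it and using [cX]
   gives [6n <= 5e]. *)
have := cardsC X; lia.
Qed.

(** The rank [r] drops along [p], so iterating [p] leads to [root], and a cycle would have no vertex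
    of maximal rank. *)
Lemma parent_tree (V : {set G}) (root : G) (p : G -> G) (r : G -> nat) :
  root \in V ->
  (forall x, x \in V -> x != root -> [/\ p x \in V, adj x (p x) & r (p x) < r x]) ->
  is_tree (V, [set [set x; p x] | x in V :\ root]).
Proof.
set H := (V, _) => Vr Hp.
have adjP x y : sub_adj H x y ->
    (r y < r x /\ y = p x) \/ (r x < r y /\ x = p y).
  case/imsetP => z /setD1P[nz Vz] /set2_eqP[[-> ->]|[-> ->]];
    have [_ _] := Hp z Vz nz; by [left|right].
have sym : symmetric (sub_adj H) by move=> x y; rewrite /sub_adj setUC.
have toroot x : x \in V -> connect (sub_adj H) x root.
  have [n] := ubnP (r x); elim: n x => // n IH x; rewrite ltnS => rx Vx.
  have [->|nx] := eqVneq x root; first exact: connect0.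
  have [Vpx _ rpx] := Hp x Vx nx.
  apply: connect_trans (IH (p x) _ Vpx); last exact: leq_trans rx.
  by apply/connect1/imsetP; exists x => //; apply/setD1P.
apply/and4P; split.
- apply/andP; split.
    apply/subsetP => _ /imsetP[x /setD1P[nx Vx] ->].
    have [_ xp _] := Hp x Vx nx.
    by apply/imsetP; exists (x, p x); rewrite ?inE.
  apply/forall_inP => _ /imsetP[x /setD1P[nx Vx] ->].
  have [Vpx _ _] := Hp x Vx nx.
  by apply/subsetP => y /set2P[] ->.
- by apply/set0Pn; exists root.
- apply/forall_inP => x Vx; apply/forall_inP => y Vy.
  apply: connect_trans (toroot x Vx) _.
  by rewrite (sym_connect_sym sym) toroot.
(* Both cycle neighbours of a vertex of maximal rank are its parent. *)
apply/acyclicP => c /andP[cc uc]; rewrite ltnNge; apply/negP => c3.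
have [x0 x0c] : exists x, x \in c.
  by case: c c3 {cc uc} => // a c _; exists a; rewrite mem_head.
case: (@arg_maxnP _ x0 (mem c) r x0c) => x xc maxx.
have [i s Es] := rot_to xc.
have us : uniq (x :: s) by rewrite -Es rot_uniq.
have cs : cycle (sub_adj H) (x :: s) by rewrite -Es rot_cycle.
have ss : 3 <= size (x :: s) by rewrite -Es size_rot.
have maxs y : y \in s -> r y <= r x.
  by move=> ys; apply: maxx; rewrite -[_ y]/(y \in c) -(mem_rot i) Es inE ys orbT.
case: s us cs ss maxs {Es} => [//|y s].
(* Length at least 3 makes the neighbours [y] and [z] of [x] separate entries of the cycle, so
   uniqueness forbids that both equal [p x]. *)
case/lastP: s => [//|s z] us cs _ maxs.
have parent w : w \in y :: rcons s z -> sub_adj H x w -> w = p x.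
  by move=> ws /adjP[[_ ->] //|[lt _]]; have := maxs w ws; rewrite leqNgt lt.
move: cs; rewrite /cycle -rcons_cons rcons_path last_rcons /= => /andP[/andP[xy _] zx].
have Ey := parent y (mem_head _ _) xy.
have Ez : z = p x by apply: parent; rewrite 1?sym // inE mem_rcons mem_head orbT.
by move: us => /= /and3P[_]; rewrite Ey -Ez mem_rcons mem_head.
Qed.

End Incidence.

(** * Sharpness: the graph K_{2,3} *)

Definition K23_adj (x y : bool + 'I_3) : bool :=
  match x, y with inl _, inr _ | inr _, inl _ => true | _, _ => false end.

Lemma K23_adj_sym : symmetric K23_adj. Proof. by case=> ? []. Qed.

Lemma K23_adj_irrefl : irreflexive K23_adj. Proof. by case. Qed.

Definition K23 : sgraph := SGraph K23_adj_sym K23_adj_irrefl.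

Definition K23_edge (b : bool) (i : 'I_3) : {set K23} := [set inl b; inr i].

Lemma K23_edge_inj b c i j : K23_edge b i = K23_edge c j -> b = c /\ i = j.
Proof. by case/set2_eqP => [[[->] [->]]|[]]. Qed.

Lemma K23_edgesE : edges K23 = [set K23_edge q.1 q.2 | q : bool * 'I_3].
Proof.
apply/setP => A; apply/imsetP/imsetP => [[[[b|i] [c|j]]]|[[b i] _ ->]].
- by rewrite inE.
- by move=> _ ->; exists (b, j).
- by move=> _ ->; exists (c, i); rewrite // /K23_edge setUC.
- by rewrite inE.
- by exists (inl b, inr i); rewrite ?inE.
Qed.

Lemma card_K23 : #|K23| = 5.
Proof. by rewrite card_sum card_bool card_ord. Qed.

Lemma card_edges_K23 : #|edges K23| = 6.
Proof.
rewrite K23_edgesE card_imset ?card_prod ?card_bool ?card_ord //.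
by move=> [b i] [c j] /K23_edge_inj[/= -> ->].
Qed.

Lemma connected_K23 : connected K23.
Proof.
rewrite /connected card_K23; apply/forallP => x; apply/forallP => y.
have step (u v : K23) : K23_adj u v -> connect (@adj K23) u v by exact: connect1.
case: x y => [b|i] [c|j]; try exact: step.
  by apply: (connect_trans (step (inl b) (inr ord0) _)); rewrite // step.
by apply: (connect_trans (step (inr i) (inl true) _)); rewrite // step.
Qed.

(* Rooted at [inl b]: the vertices [inr i] hang from the root, and [inl (~~ b)],
   if present, hangs from [inr k]. *)
Definition K23_tree (b : bool) (k : 'I_3) (V : {set K23}) : presubgraph K23 :=
  (V, [set [set x; (if x is inr _ then inl b else inr k) : K23] | x in V :\ inl b]).

Lemma K23_tree_is_tree b k (V : {set K23}) :
  inl b \in V -> (inl (~~ b) \in V -> inr k \in V) -> is_tree (K23_tree b k V).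
Proof.
(* The rank is the distance to [inl b] in [K23]. *)
move=> Vb Vk; pose r (x : K23) := if x is inl c then 2 * (c != b) else 1.
apply: (@parent_tree K23 V (inl b)
  (fun x => if x is inr _ then inl b else inr k) r) => // -[c|i] Vx nx.
  have ncb : c != b by apply: contraNneq nx => ->.
  split=> //; last by rewrite /r ncb.
  by apply: Vk; move: ncb Vx; case: (b); case: (c).
by split=> //; rewrite /r eqxx.
Qed.

Lemma K23_tree_edges b k (V : {set K23}) A : A \in sub_edges (K23_tree b k V) ->
  (exists2 i, A = K23_edge b i & inr i \in V) \/
  (A = K23_edge (~~ b) k /\ inl (~~ b) \in V).
Proof.
case/imsetP => -[c|i] /setD1P[nx Vx] ->; [right|left].
  have -> : ~~ b = c by move: nx; case: (b); case: (c) => //; rewrite eqxx.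
  by [].
by exists i; rewrite // /K23_edge setUC.
Qed.

(** One tree is rooted at each [inl b]. If the opposite vertex [inl (~~ b)] is a terminal, it is
    reached through a connector [inr (k b)] outside [S]; the trees stay disjoint off [S] when the
    connectors differ. *)
Lemma K23_kappa_ge2 (S : {set K23}) : #|S| = 3 -> 2 <= kappa S.
Proof.
move=> S3; have S1 : 1 < #|S| by rewrite S3.
(* As many [inr i] are missing from [S] as there are [inl b] in [S]. *)
have [k kS kinj] : exists2 k : bool -> 'I_3,
    forall b, inl (~~ b) \in S -> inr (k b) \notin S
  & inl true \in S -> inl false \in S -> k true != k false.
  pose B := [set b | inl b \in S]; pose K := [set i | inr i \notin S].
  have cBK : #|B| = #|K|.
    (* Both [#|B| + #|~: K|], which is [#|S|], and [#|K| + #|~: K|] equal 3. *)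
    have cK := cardsC K; rewrite card_ord in cK.
    move: S3; rewrite -sum1_card big_sumType /= !sum1_card.
    rewrite (eq_card (B := B)) => [|b]; last by rewrite !inE.
    rewrite (eq_card (A := fun i => _) (B := ~: K)) => [|i]; last by rewrite !inE negbK.
    by move=> cS; apply: (@addIn #|~: K|); rewrite cS cK.
  (* This matches [B] with [K] by position; the default [ord0] is not reached when [~~ b] is in
     [B]. *)
  pose k b := nth ord0 (enum K) (index (~~ b) (enum B)).
  have ltB b : b \in B -> index b (enum B) < size (enum K).
    by rewrite -cardE -cBK cardE index_mem mem_enum.
  exists k => [b Sb|St Sf].
    have /(mem_nth ord0) : index (~~ b) (enum B) < size (enum K) by rewrite ltB ?inE.
    by rewrite mem_enum inE.
  rewrite /k nth_uniq ?enum_uniq ?ltB ?inE //.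
  apply/eqP => /(f_equal (nth true (enum B))).
  by rewrite !nth_index // mem_enum inE.
pose V b := S :|: [set x : K23 | (x == inl b) || (x == inr (k b)) && (inl (~~ b) \in S)].
have VE b x : (x \in V b) =
  [|| x \in S, x == inl b | (x == inr (k b)) && (inl (~~ b) \in S)] by rewrite !inE.
have Vk b : inl (~~ b) \in V b -> inl (~~ b) \in S.
  by rewrite VE; case/or3P => //; case: (b).
(* The connector of one tree avoids the other tree: it is outside [S] and, by [kinj], differs from
   the other connector. *)
have kV b : inl (~~ b) \in S -> inr (k b) \notin V (~~ b).
  move=> Sb; rewrite VE (negbTE (kS b Sb)) negbK /=.
  apply/andP => -[/eqP[E] Sb'].
  by case: b E Sb Sb' => /= E s s'; have := kinj; rewrite E eqxx; auto.
have tree b : is_tree (K23_tree b (k b) (V b)).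
  apply: K23_tree_is_tree; first by rewrite VE eqxx orbT.
  by move/Vk => Sb; rewrite VE eqxx Sb !orbT.
have sub b : S \subset V b by apply: subsetUl.
apply/(kappa_ge2P S1).
exists (K23_tree true (k true) (V true)), (K23_tree false (k false) (V false)).
split; try by split; [apply: tree | apply: sub].
  (* A common edge would join one root to the connector of the other tree, which [kV] excludes. *)
  apply/pred0P => A; apply/negP => /andP[].
  move=> /K23_tree_edges[[i -> Vi]|[-> Vf]].
    case/K23_tree_edges=> [[j /K23_edge_inj[//]]|[/K23_edge_inj[_ E] /Vk/kV/=]].
    by rewrite -E Vi.
  case/K23_tree_edges=> [[j /K23_edge_inj[_ <-]]|[/K23_edge_inj[]]//].
  by have := kV true (Vk true Vf) => /= /negbTE ->.
apply/setP => x; rewrite inE -/(sub_vertices _) /=.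
apply/andP/idP => [[]|Sx]; last by rewrite !(subsetP (sub _)).
rewrite {1}VE => /or3P[//|/eqP->|/andP[/eqP-> Sf]].
  by move/(Vk false).
by rewrite (negbTE (kV true Sf)).
Qed.

Lemma K23_kconnectivity : kconnectivity K23 3 = 2.
Proof.
have [|[S S3 <-] kmin] := @kconnectivity_min K23 3; first by rewrite card_K23.
apply/eqP; rewrite eqn_leq K23_kappa_ge2 // andbT.
(* For the upper bound, a triple containing some [inr i] suffices, as [inr i] has degree 2. *)
pose S0 : {set K23} := [set inr i | i in 'I_3].
have S03 : #|S0| = 3 by rewrite card_imset ?card_ord // => i j [].
have S01 : 1 < #|S0| by rewrite S03.
have S0v : inr ord0 \in S0 by apply/imsetP; exists ord0.
have le_deg := kappa_le_degree S01 S0v.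
apply: leq_trans (kmin _ S03) _; apply: leq_trans le_deg _.
apply: (@leq_trans #|[set K23_edge b ord0 | b : bool]|); last first.
  by apply: leq_trans (leq_imset_card _ _) _; rewrite card_bool.
apply/subset_leq_card/subsetP => A; rewrite inE K23_edgesE.
case/andP => /imsetP[[b i] _ ->] /set2P[//|[<-]].
by apply/imsetP; exists b.
Qed.

Theorem theorem2p1 :
  (forall G : sgraph,
     connected G -> 3 <= #|G| -> kconnectivity G 3 = 2 ->
     ((6 / 5) * #|G|%:R <= #|edges G|%:R :> rat)%R) /\
  (exists G : sgraph,
     [/\ connected G, 3 <= #|G|, kconnectivity G 3 = 2
       & (#|edges G|%:R = (6 / 5) * #|G|%:R :> rat)%R]).
Proof.
split=> [G _ n3 k2|].
  have := edges_lower_bound n3; rewrite k2 => /(_ isT).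
  rewrite -(Num.Theory.ler_nat rat) !GRing.natrM; lra.
exists K23; split; rewrite ?card_K23 ?card_edges_K23 //.
- exact: connected_K23.
- exact: K23_kconnectivity.
Qed.
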